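(* Let $n,m\in\mathbb{N}$, and let $X\subset\mathbb{R}^n$, functions $f_1,\dots,f_m$ and a constant $C>0$ satisfy Assumption A of the context; put $f=\sum_{i=1}^m f_i$, $f^*=\inf_{x\in X} f(x)$ and $X^*=\{x\in X\mid f(x)=f^*\}$. Let $\{x_k\}_{k\ge 0}$ be generated by the incremental cutting-plane algorithm of the context with memory size $W$, step sizes $\{t_k\}$ and evaluation schedule $\{I_k\}$. Assume that every component is evaluated at least once in every $W$ consecutive iterations, i.e. $i\in\bigcup_{l=0}^{W-1} I_{k+l}$ for all $k\ge 0$ and all $i\in\{1,\dots,m\}$, that $$t_k>0\ (\forall k),\quad t_k\ge t_{k+1}\ (\forall k),\quad \sum_{k=0}^\infty t_k=\infty,\quad \sum_{k=0}^\infty t_k^2<\infty ,$$ and that the set of optimal solutions $X^*$ is nonempty. Then the sequence $\{x_k\}$ converges to some element of $X^*$.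
   Context: Assumption A: (1) $X\subset\mathbb{R}^n$ is nonempty, closed and convex. (2) For $i=1,\dots,m$, $f_i:\mathbb{R}^n\to\mathbb{R}$ is convex, and is finite and subdifferentiable over $X$. (3) $C>0$ is such that $\|g\|\le C$ for all $i\in\{1,\dots,m\}$, all $x\in X$ and all $g\in\partial f_i(x)$, where $\partial f_i(x)$ is the subdifferential of $f_i$ at $x$ and $\|\cdot\|$ is the Euclidean norm. Incremental cutting-plane algorithm: Select $x_0\in X$, a memory size $W\in\mathbb{N}$, $W\ge1$, step sizes $t_k>0$ ($k\ge 0$) and an evaluation schedule $I_k\subset\{1,\dots,m\}$ ($k\ge 0$). For $k=0,1,2,\dots$: (a) for each $i\in I_k$ evaluate $f_i(x_k)$ and some subgradient $g_i(x_k)\in\partial f_i(x_k)$ (an arbitrary choice); (b) let $x_{k+1}=\arg\min_{x\in X}\breve f_k(x)$ (the unique minimizer), where $$\breve f_k(x)=\sum_{i=1}^m \hat f_{k,i}(x)+\frac{1}{2t_k}\|x-x_k\|^2,$$ $$\hat f_{k,i}(x)=\max_{l\in B_{k,i}}\left\{ f_i(x_{k-l})+g_i(x_{k-l})^T(x-x_{k-l})\right\}\ \text{ if } B_{k,i}\neq\emptyset,\qquad \hat f_{k,i}(x)=0\ \text{ otherwise},$$ $$B_{k,i}=\{l\in\mathbb{Z}\mid 0\le l\le\min\{k,W-1\},\ i\in I_{k-l}\}.$$ *)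

(* Defs.v *)
From mathcomp Require Export all_boot all_order all_algebra.
From mathcomp Require Export all_classical all_reals all_analysis.

Export Order.TTheory GRing.Theory Num.Theory.
Export numFieldNormedType.Exports.

Set Implicit Arguments.
Unset Strict Implicit.
Unset Printing Implicit Defensive.

Local Open Scope classical_set_scope.
Local Open Scope ring_scope.

Section Euclidean.
Context {R : realType} {n : nat}.

Definition dotv (u v : 'rV[R]_n) : R := \sum_(j < n) u 0 j * v 0 j.

(* The library norm `|u| on matrices is the sup norm; both norms induce the
   library topology on 'rV[R]_n. *)
Definition enorm (u : 'rV[R]_n) : R := Num.sqrt (dotv u u).

Definition subdifferential (f : 'rV[R]_n -> R) (x : 'rV[R]_n) :
  set 'rV[R]_n := [set g | forall y, f x + dotv g (y - x) <= f y].

End Euclidean.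

Section Optimization.
Context {R : realType} {T : Type}.
Implicit Types (X : set T) (F : T -> R).

Definition is_argmin X F (z : T) : Prop :=
  X z /\ forall y, X y -> F z <= F y.

(* The infimum is taken in \bar R: the real-valued inf of a set that is
   unbounded below is a junk value. *)
Definition inf_value X F : \bar R := ereal_inf [set (F x)%:E | x in X].

Definition optimal_set X F : set T :=
  [set x | X x /\ (F x)%:E = inf_value X F].

End Optimization.

Section IncrementalCuttingPlane.
Context {R : realType} {n m : nat}.
Variables (f : 'I_m -> 'rV[R]_n -> R) (W : nat) (t : nat -> R)
  (I : nat -> {set 'I_m}).
(* g k i is the subgradient of f i at x k computed at iteration k; it is
   unconstrained, and never used, when i is not in I k. *)
Variables (x : nat -> 'rV[R]_n) (g : nat -> 'I_m -> 'rV[R]_n).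

Definition linearization (k : nat) (i : 'I_m) (y : 'rV[R]_n) : R :=
  f i (x k) + dotv (g k i) (y - x k).

(* The index type encodes 0 <= l <= min {k, W - 1}; in particular k - l is
   never truncated. *)
Definition memory (k : nat) (i : 'I_m) : {set 'I_(minn k W.-1).+1} :=
  [set l : 'I_(minn k W.-1).+1 | i \in I (k - l)]%SET.

(* Starting the iterated maximum from the value at an element l0 of the memory
   makes it the maximum over the memory, whatever l0 is. *)
Definition component_model (k : nat) (i : 'I_m) (y : 'rV[R]_n) : R :=
  if [pick l in memory k i] is Some l0 then
    \big[Num.max/linearization (k - l0) i y]_(l in memory k i)
      linearization (k - l) i y
  else 0.

Definition proximal_model (k : nat) (y : 'rV[R]_n) : R :=
  \sum_(i < m) component_model k i y + (2 * t k)^-1 * enorm (y - x k) ^+ 2.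

(* The argmin is unique because the model is strongly convex, so being a
   minimizer determines the next iterate. *)
Record incremental_cutting_plane (X : set 'rV[R]_n) : Prop := {
  icp_init : X (x 0%N);
  icp_memory : (1 <= W)%N;
  icp_step : forall k, 0 < t k;
  icp_subgradient :
    forall k i, i \in I k -> subdifferential (f i) (x k) (g k i);
  icp_next : forall k, is_argmin X (proximal_model k) (x k.+1)
}.

End IncrementalCuttingPlane.

(* Main.v *)
Require Import Defs.
From mathcomp Require Import zify ring lra.

(* Write f for the sum of the components.  The model minimized at step k is
   (2 t_k)^-1-strongly convex and its slope away from the proximal term is at
   most m C, so consecutive iterates are within m C t_k of each other.  Once W
   steps have elapsed every memory is nonempty, so the model minorizes f, and
   at x_(k+1) it is below f(x_(k+1)) by at most O(t_(k-W+1)): every stored cut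
   was taken at one of the last W iterates.  The three-point inequality for the
   proximal step then gives, for every y in X,
     |x_(k+1) - y|^2 <= |x_k - y|^2 - 2 t_k (f(x_(k+1)) - f(y))
                        + K t_(k-W+1)^2.
   With y optimal, the divergence of the sum of the t_k forces
   liminf f(x_k) = f^*, and the iterates are bounded; a cluster point z of a
   minimizing subsequence is optimal.  With y = z the summability of the
   t_k^2 upgrades subsequential convergence to convergence. *)

Set Implicit Arguments.
Unset Strict Implicit.
Unset Printing Implicit Defensive.

Local Open Scope classical_set_scope.
Local Open Scope ring_scope.

(** * Euclidean norm, its comparison with the sup norm, and compactness *)

Section EuclideanTheory.
Context {R : realType} {n : nat}.
Implicit Types (u v w y z : 'rV[R]_n) (a : R).

Lemma dotvC u v : dotv u v = dotv v u.
Proof. by apply: eq_bigr => j _; rewrite mulrC. Qed.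

Lemma dotvDl u v w : dotv (u + v) w = dotv u w + dotv v w.
Proof. by rewrite -big_split; apply: eq_bigr => j _; rewrite mxE mulrDl. Qed.

Lemma dotvZl a u w : dotv (a *: u) w = a * dotv u w.
Proof. by rewrite mulr_sumr; apply: eq_bigr => j _; rewrite mxE mulrA. Qed.

Lemma dotvNl u w : dotv (- u) w = - dotv u w.
Proof. by rewrite -scaleN1r dotvZl mulN1r. Qed.

Lemma dotvDr u v w : dotv w (u + v) = dotv w u + dotv w v.
Proof. by rewrite dotvC dotvDl !(dotvC w). Qed.

Lemma dotvZr a u w : dotv w (a *: u) = a * dotv w u.
Proof. by rewrite dotvC dotvZl (dotvC w). Qed.

Lemma dotvNr u w : dotv w (- u) = - dotv w u.
Proof. by rewrite dotvC dotvNl (dotvC w). Qed.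

Definition dotvE := (dotvDl, dotvDr, dotvNl, dotvNr, dotvZl, dotvZr).

Lemma dotv_ge0 u : 0 <= dotv u u.
Proof. by apply: sumr_ge0 => j _; rewrite -expr2 sqr_ge0. Qed.

Lemma enorm_ge0 u : 0 <= enorm u.
Proof. exact: sqrtr_ge0. Qed.

Lemma sqr_enorm u : enorm u ^+ 2 = dotv u u.
Proof. exact: sqr_sqrtr (dotv_ge0 u). Qed.

Lemma enorm0 : enorm (0 : 'rV[R]_n) = 0.
Proof. by rewrite /enorm -(scale0r 0) dotvZl mul0r sqrtr0. Qed.

Lemma enormN u : enorm (- u) = enorm u.
Proof. by rewrite /enorm !dotvE opprK. Qed.

Lemma enormBC u v : enorm (u - v) = enorm (v - u).
Proof. by rewrite -enormN opprB. Qed.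

Lemma normr_coord_le_enorm u j : `|u 0 j| <= enorm u.
Proof.
rewrite -ler_sqr ?nnegrE ?enorm_ge0 // sqr_enorm real_normK ?num_real //.
rewrite /dotv (bigD1 j) //= -expr2 lerDl.
by apply: sumr_ge0 => i _; rewrite -expr2 sqr_ge0.
Qed.

Lemma mx_norm_le_enorm u : `|u| <= enorm u.
Proof.
rewrite [`|u|]mx_normrE; apply/bigmax_leP; split=> [|[i j] _ /=].
  exact: enorm_ge0.
by rewrite ord1 normr_coord_le_enorm.
Qed.

Lemma normr_coord_le_mx_norm u j : `|u 0 j| <= `|u|.
Proof. by rewrite [X in _ <= X]mx_normrE; apply: (le_bigmax _ _ (0, j)). Qed.

Lemma enorm_le_mx_norm u : enorm u <= Num.sqrt n%:R * `|u|.
Proof.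
rewrite -[`|u|]ger0_norm // -sqrtr_sqr -sqrtrM //.
rewrite ler_sqrt; last by rewrite mulr_ge0 ?sqr_ge0.
have -> : n%:R * `|u| ^+ 2 = \sum_(j < n) `|u| ^+ 2.
  by rewrite sumr_const card_ord mulr_natl.
apply: ler_sum => j _.
by rewrite -expr2 -(real_normK (num_real (u 0 j))) ler_sqr ?nnegrE //
  normr_coord_le_mx_norm.
Qed.

Lemma enorm_eq0 u : enorm u = 0 -> u = 0.
Proof.
move=> u0; apply/rowP => j; rewrite mxE; apply/eqP; rewrite -normr_le0 -u0.
exact: normr_coord_le_enorm.
Qed.

(** Cauchy-Schwarz: expand the square of [enorm v *: u - enorm u *: v] and divide by
    [enorm u * enorm v], the zero cases being apart. *)
Lemma dotv_le_enorm u v : dotv u v <= enorm u * enorm v.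
Proof.
have [/eqP|u0] := eqVneq (enorm u) 0.
  by move=> /eqP u0; rewrite u0 mul0r (enorm_eq0 u0) -(scale0r 0) dotvZl mul0r.
have [/eqP|v0] := eqVneq (enorm v) 0.
  by move=> /eqP v0; rewrite v0 mulr0 (enorm_eq0 v0) -(scale0r 0) dotvZr mul0r.
have uv0 : 0 < enorm u * enorm v by rewrite mulr_gt0 // lt0r ?u0 ?v0 enorm_ge0.
have := dotv_ge0 (enorm v *: u - enorm u *: v).
rewrite !dotvE (dotvC v u) -!sqr_enorm => h.
rewrite -(ler_pM2l uv0); nra.
Qed.

Lemma enormD u v : enorm (u + v) <= enorm u + enorm v.
Proof.
rewrite -ler_sqr ?nnegrE ?addr_ge0 ?enorm_ge0 // sqr_enorm !dotvE (dotvC v u).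
rewrite -!sqr_enorm; have := dotv_le_enorm u v; nra.
Qed.

Lemma enormB_trans u v w : enorm (u - w) <= enorm (u - v) + enorm (v - w).
Proof. by apply: le_trans (enormD _ _); rewrite addrA subrK. Qed.

(** Bolzano-Weierstrass: a Euclidean ball lies in a product of segments, which is compact. *)
Lemma seq_cluster (v : nat -> 'rV[R]_n) (c : 'rV[R]_n) (M : R) :
    (forall k, enorm (v k - c) <= M) ->
  exists z, forall e N, 0 < e -> exists2 k, (N <= k)%N & enorm (z - v k) < e.
Proof.
move=> vM.
pose K := [set z : 'rV[R]_n | forall j, `[c 0 j - M, c 0 j + M]%classic (z 0 j)].
have cK : compact K 
  by apply: (@rV_compact R n (fun j => `[c 0 j - M, c 0 j + M]%classic)) => j;
    exact: segment_compact.
have [] := cK (v @ \oo).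
  exists 0%N => // k _ j /=; rewrite in_itv /=.
  have := le_trans (normr_coord_le_enorm _ j) (vM k).
  by rewrite !mxE ler_norml => /andP[? ?]; apply/andP; split; lra.
move=> z [_ zv]; exists z => e N e0.
(* The factor [Num.sqrt n%:R] converts a sup-norm ball into a Euclidean one; the added 1 keeps the
   divisor positive when [n = 0]. *)
have s0 : 0 < Num.sqrt n%:R + 1 :> R by rewrite ltr_wpDl ?sqrtr_ge0.
have [||_ [[k /= Nk <-] zk]] :=
  zv [set v k | k in [set k | (N <= k)%N]] (ball z (e / (Num.sqrt n%:R + 1))).
- by exists N => // k Nk; exists k.
- by apply: nbhsx_ballx; rewrite divr_gt0.
exists k => //; apply: le_lt_trans (enorm_le_mx_norm _) _.
move: zk; rewrite -ball_normE /= ltr_pdivlMr // mulrDr mulr1 (mulrC `|_|) => zk.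
by apply: le_lt_trans zk; rewrite lerDl.
Qed.

Lemma cvg_enorm (v : nat -> 'rV[R]_n) (z : 'rV[R]_n) :
    (forall e, 0 < e -> exists N, forall k, (N <= k)%N -> enorm (z - v k) < e) ->
  v k @[k --> \oo] --> z.
Proof.
move=> vz; apply/cvgrPdist_lt => e /vz[N Nv]; exists N => // k /Nv.
exact/le_lt_trans/mx_norm_le_enorm.
Qed.

End EuclideanTheory.

(** * Real sequences that decrease up to summable errors *)

Section QuasiFejer.
Context {R : realType}.
Implicit Types (a b s d : nat -> R) (e B : R).

Lemma bounded_tail b B :
    (forall k, b k <= B) -> forall e, 0 < e -> exists N, forall k, b k - b N < e.
Proof.
move=> bB e e0.
have hs : has_sup (range b).
  by split; [exists (b 0%N), 0%N | exists B => _ [k _ <-]].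
have [_ [N _ <-] hN] := sup_adherent e0 hs.
exists N => k; have : b k <= sup (range b) by apply: ub_le_sup; [case: hs|exists k].
lra.
Qed.

Lemma descent_telescope a b s d e N :
    (forall k, a k.+1 <= a k - s k * d k + b k) -> (forall k, 0 <= s k) ->
    (forall k, (N <= k)%N -> e <= d k) ->
  forall k, (N <= k)%N ->
    a k <= a N - e * (\sum_(0 <= i < k) s i - \sum_(0 <= i < N) s i)
           + (\sum_(0 <= i < k) b i - \sum_(0 <= i < N) b i).
Proof.
move=> ha hs hd k /subnKC <-; elim: (k - N)%N => [|j IH].
  by rewrite addn0; lra.
rewrite addnS !big_nat_recr //=.
have := ha (N + j)%N; have := ler_wpM2l (hs (N + j)%N) (hd _ (leq_addr j N)).
lra.
Qed.

(** If [d] stayed at or above [e] from [N] on, the diverging sum of [s] would push [a] below zero,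
    since the errors add at most [B]. *)
Lemma descent_inf a b s d B :
    (forall k, 0 <= a k) -> (forall k, a k.+1 <= a k - s k * d k + b k) ->
    (forall k, 0 <= s k) -> (forall A, exists k, A < \sum_(0 <= i < k) s i) ->
    (forall k, 0 <= b k) -> (forall k, \sum_(0 <= i < k) b i <= B) ->
  forall e N, 0 < e -> exists2 k, (N <= k)%N & d k < e.
Proof.
move=> a0 ha s0 sI b0 bB e N e0; apply: contrapT => H.
have hd k : (N <= k)%N -> e <= d k.
  by move=> Nk; rewrite leNgt; apply/negP => dk; apply: H; exists k.
(* Past this threshold the decrease accumulated after [N] exceeds [a N + B]; including the sum up to
   [N] also forces [N <= k]. *)
have [k hk] := sI ((a N + B) / e + \sum_(0 <= i < N) s i).
have Nk : (N <= k)%N.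
  rewrite leqNgt; apply/negP => /ltnW kN.
  have : \sum_(0 <= i < k) s i <= \sum_(0 <= i < N) s i.
    by rewrite (big_cat_nat (leq0n k) kN) //= lerDl sumr_ge0.
  have : 0 <= (a N + B) / e.
    rewrite divr_ge0 ?addr_ge0 ?(ltW e0) //.
    by apply: le_trans (bB 0%N); rewrite big_geq.
  lra.
have := descent_telescope ha s0 hd Nk; have := a0 k; have := bB k.
have : 0 <= \sum_(0 <= i < N) b i by rewrite sumr_ge0.
have : a N + B < e * (\sum_(0 <= i < k) s i - \sum_(0 <= i < N) s i).
  by rewrite mulrC -ltr_pdivrMr //; lra.
lra.
Qed.

Lemma quasi_fejer_telescope a b N :
    (forall k, a k.+1 <= a k + b k) -> forall k, (N <= k)%N ->
  a k <= a N + (\sum_(0 <= i < k) b i - \sum_(0 <= i < N) b i).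
Proof.
move=> ha k Nk.
have ha' j : a j.+1 <= a j - 0 * 0 + b j by rewrite mul0r subr0.
have := descent_telescope ha' (fun=> lexx 0) (fun _ _ => lexx 0) Nk.
by rewrite mul0r subr0.
Qed.

Lemma quasi_fejer_bounded a b B :
    (forall k, a k.+1 <= a k + b k) -> (forall k, \sum_(0 <= i < k) b i <= B) ->
  forall k, a k <= a 0%N + B.
Proof.
move=> ha bB k; have := quasi_fejer_telescope ha (leq0n k).
rewrite [X in _ - X]big_geq //; have := bB k; lra.
Qed.

(** Half of [e] covers one small value [a p], the other half all errors after [p]. *)
Lemma quasi_fejer_cvg0 a b B :
    (forall k, a k.+1 <= a k + b k) ->
    (forall k, 0 <= b k) -> (forall k, \sum_(0 <= i < k) b i <= B) ->
    (forall e N, 0 < e -> exists2 k, (N <= k)%N & a k < e) ->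
  forall e, 0 < e -> exists N, forall k, (N <= k)%N -> a k < e.
Proof.
move=> ha b0 bB ainf e e0.
have e2 : 0 < e / 2 by rewrite divr_gt0.
have [N hN] := bounded_tail bB e2.
have [p Np ap] := ainf _ N e2.
exists p => k pk.
have : \sum_(0 <= i < N) b i <= \sum_(0 <= i < p) b i.
  by rewrite (big_cat_nat (leq0n N) Np) //= lerDl sumr_ge0.
have := quasi_fejer_telescope ha pk; have := hN k; lra.
Qed.

Lemma nneseries_lty_ub (u : nat -> R) : (forall k, 0 <= u k) ->
    (\sum_(0 <= k <oo) (u k)%:E < +oo)%E ->
  exists B, forall k, \sum_(0 <= i < k) u i <= B.
Proof.
move=> u0 us; exists (fine (\sum_(0 <= k <oo) (u k)%:E)%E) => k.
rewrite -lee_fin fineK.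
  rewrite -sumEFin; apply: nneseries_lim_ge => i _ _.
  by rewrite lee_fin.
by rewrite ge0_fin_numE //; apply: nneseries_ge0 => i _ _; rewrite lee_fin.
Qed.

Lemma nneseries_pinfty_unbounded (u : nat -> R) : (forall k, 0 <= u k) ->
    (\sum_(0 <= k <oo) (u k)%:E = +oo)%E ->
  forall A, exists k, A < \sum_(0 <= i < k) u i.
Proof.
move=> u0 us A; apply: contrapT => H.
have : (\sum_(0 <= k <oo) (u k)%:E <= A%:E)%E.
  apply: lime_le; first by apply: is_cvg_nneseries => i _ _; rewrite lee_fin.
  apply: nearW => k; rewrite sumEFin lee_fin leNgt; apply/negP => Ak.
  by apply: H; exists k.
by rewrite us leye_eq.
Qed.

End QuasiFejer.

(** * The proximal step over a convex set *)

Lemma convex_set_segment {R : realType} {n : nat} (X : set 'rV[R]_n) (a : R) u v :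
  convex_set X -> X u -> X v -> 0 <= a -> a <= 1 -> X (u + a *: (v - u)).
Proof.
move=> cX Xu Xv a0 a1.
have := cX v u (Itv01 a0 a1); rewrite !inE => /(_ Xv Xu).
rewrite /conv /= /unstable.onem scalerBl scale1r scalerBr.
by congr X; rewrite addrCA.
Qed.

(* Strong convexity of the proximal objective: test minimality of [z] along the
   segment from [z] to [y] and compare the first-order terms. *)
Lemma prox_three_point {R : realType} {n : nat} (X : set 'rV[R]_n)
    (M : 'rV[R]_n -> R) (c : R) (x z y : 'rV[R]_n) :
    convex_set X ->
    (forall a u v, 0 <= a -> a <= 1 -> M (u + a *: (v - u)) <= M u + a * (M v - M u)) ->
    0 < c -> is_argmin X (fun w => M w + c * enorm (w - x) ^+ 2) z -> X y ->
  M z + c * enorm (z - x) ^+ 2 + c * enorm (y - z) ^+ 2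
    <= M y + c * enorm (y - x) ^+ 2.
Proof.
move=> cX cM c0 [Xz zmin] Xy.
(* [a * (D + a * Q)] bounds from above the change of the objective from [z] to [z + a *: (y - z)];
   letting [a] be small shows [0 <= D]. *)
pose D := M y - M z + 2 * c * dotv (y - z) (z - x).
pose Q := c * enorm (y - z) ^+ 2.
have Q0 : 0 <= Q by rewrite mulr_ge0 ?sqr_ge0 // ltW.
have DQ a : 0 <= a -> a <= 1 -> 0 <= a * (D + a * Q).
  move=> a0 a1; have := zmin _ (convex_set_segment cX Xz Xy a0 a1).
  have -> : z + a *: (y - z) - x = (z - x) + a *: (y - z).
    by rewrite addrAC.
  rewrite /D /Q !sqr_enorm; have := cM a z y a0 a1.
  move: (z - x) (y - z) => u v; rewrite !dotvE (dotvC u v); nra.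
have D0 : 0 <= D.
  rewrite leNgt; apply/negP => D_lt0.
  have QD : 0 < Q - D by lra.
  (* This weight lies in (0, 1] even if [Q = 0], and turns [D + a * Q] into a negative number. *)
  have a0 : 0 < - D / (Q - D) by rewrite divr_gt0 // oppr_gt0.
  have := DQ (- D / (Q - D)) (ltW a0).
  rewrite ler_pdivrMr // mul1r => /(_ _); rewrite pmulr_rge0 //.
  have -> : D + - D / (Q - D) * Q = - D ^+ 2 / (Q - D) by field; rewrite gt_eqF.
  rewrite ler_pdivlMr // mul0r => h.
  have : 0 <= - D ^+ 2 by apply: h; lra.
  nra.
have -> : y - x = (y - z) + (z - x) by rewrite addrA subrK.
move: D0; rewrite /D !sqr_enorm.
move: (z - x) (y - z) => u v; rewrite !dotvE (dotvC u v); lra.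
Qed.

(** * Cutting-plane models and the descent of the iterates *)

Section Algorithm.
Context {R : realType} {n m : nat}.
Variables (X : set 'rV[R]_n) (f : 'I_m -> 'rV[R]_n -> R) (C : R) (W : nat)
  (t : nat -> R) (I : nat -> {set 'I_m})
  (x : nat -> 'rV[R]_n) (g : nat -> 'I_m -> 'rV[R]_n).

Local Notation lin := (linearization f x g).
Local Notation memory := (memory W I).
Local Notation component := (component_model f W I x g).

Lemma linearization_le_component k i y (l : 'I_(minn k W.-1).+1) :
  l \in memory k i -> lin (k - l) i y <= component k i y.
Proof.
move=> lB; rewrite /component_model; case: pickP => [l0 _|/(_ l)].
  exact: (le_bigmax_cond _ (fun j : 'I__ => lin (k - j) i y)).
by rewrite lB.
Qed.

Lemma component_attained k i y : memory k i != finset.set0 ->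
  exists2 l : 'I_(minn k W.-1).+1,
    l \in memory k i & component k i y = lin (k - l) i y.
Proof.
case/finset.set0Pn => l lB; rewrite /component_model.
case: pickP => [l0 l0B|/(_ l)]; last by rewrite lB.
elim/big_ind: _ => [|a b [la laB ->] [lb lbB ->]|j jB]; first by exists l0.
- by case: (leP (lin (k - la) i y)) => _; [exists lb | exists la].
- by exists j.
Qed.

Lemma component0 k i y : memory k i = finset.set0 -> component k i y = 0.
Proof. by rewrite /component_model => ->; case: pickP => // l; rewrite inE. Qed.

(** The cut attaining the maximum at the intermediate point is affine and lies below the model at
    both ends. *)
Lemma component_convex k i a u v : 0 <= a -> a <= 1 ->
  component k i (u + a *: (v - u))
    <= component k i u + a * (component k i v - component k i u).
Proof.
move=> a0 a1; have [B0|/component_attained Bn] := eqVneq (memory k i) finset.set0.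
  by rewrite !component0 // subrr mulr0 addr0.
have [l lB ->] := Bn (u + a *: (v - u)).
have -> : lin (k - l) i (u + a *: (v - u))
    = (1 - a) * lin (k - l) i u + a * lin (k - l) i v.
  by rewrite /linearization !dotvE; ring.
have := linearization_le_component u lB; have := linearization_le_component v lB.
nra.
Qed.

Hypothesis X_convex : convex_set X.
Hypothesis f_subdifferentiable :
  forall i y, X y -> subdifferential (f i) y !=set0.
Hypothesis C_gt0 : 0 < C.
Hypothesis subgradient_bound :
  forall i y h, X y -> subdifferential (f i) y h -> enorm h <= C.
Hypothesis algorithm : incremental_cutting_plane f W t I x g X.

(** A subgradient at [z] alone suffices, so [y] may lie outside [X]. *)
Lemma lower_lipschitz i y z : X z -> f i z - C * enorm (y - z) <= f i y.
Proof.
move=> Xz; have [h hz] := f_subdifferentiable i Xz.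
have := hz y; have := subgradient_bound Xz hz.
have := dotv_le_enorm (- h) (y - z); rewrite enormN dotvNl.
have := enorm_ge0 (y - z); nra.
Qed.

Lemma iterate_mem k : X (x k).
Proof.
by case: k => [|k]; [case: algorithm | case: algorithm => _ _ _ _ /(_ k) []].
Qed.

Lemma memory_subgradient k i l : l \in memory k i ->
  subdifferential (f i) (x (k - l)) (g (k - l) i).
Proof. by rewrite inE; case: algorithm => _ _ _ + _ => /(_ (k - l)%N i). Qed.

Lemma memory_slope k i l : l \in memory k i -> enorm (g (k - l) i) <= C.
Proof. by move/memory_subgradient; apply: subgradient_bound; exact: iterate_mem. Qed.

(** The cut active at [y] has slope at most [C] and stays below the model at [z]. *)
Lemma component_lipschitz k i y z :
  component k i y - component k i z <= C * enorm (y - z).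
Proof.
have [B0|/component_attained Bn] := eqVneq (memory k i) finset.set0.
  by rewrite !component0 // subrr mulr_ge0 ?enorm_ge0 // ltW.
have [l lB ->] := Bn y.
have := linearization_le_component z lB.
have := dotv_le_enorm (g (k - l) i) (y - z); have := memory_slope lB.
rewrite /linearization !dotvE; have := enorm_ge0 (y - z).
nra.
Qed.

Lemma component_le k i y : memory k i != finset.set0 -> component k i y <= f i y.
Proof.
by case/(component_attained y) => l lB ->; exact: (memory_subgradient lB y).
Qed.

(** Any one stored cut will do: [C * D] is lost in passing from [f i z] to the value at the base
    point of the cut, and [C * D] again along the cut back to [z]. *)
Lemma component_ge k i z D : X z -> memory k i != finset.set0 ->
    (forall l : 'I_(minn k W.-1).+1, enorm (z - x (k - l)) <= D) ->
  f i z - 2 * C * D <= component k i z.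
Proof.
move=> Xz /finset.set0Pn[l lB] zD.
apply: le_trans (linearization_le_component z lB).
have := lower_lipschitz i (x (k - l)) Xz; rewrite enormBC.
have := dotv_le_enorm (- g (k - l) i) (z - x (k - l)); rewrite dotvNl enormN.
have := ler_wpM2r (enorm_ge0 (z - x (k - l))) (memory_slope lB).
have := ler_wpM2l (ltW C_gt0) (zD l).
rewrite /linearization; lra.
Qed.

Lemma iterate_three_point k y : X y ->
  enorm (x k.+1 - y) ^+ 2 <= enorm (x k - y) ^+ 2 - enorm (x k.+1 - x k) ^+ 2
    + 2 * t k * (\sum_(i < m) component k i y - \sum_(i < m) component k i (x k.+1)).
Proof.
move=> Xy; have [_ _ /(_ k) tk _ /(_ k) xmin] := algorithm.
have cM (a : R) u v : 0 <= a -> a <= 1 ->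
    \sum_(i < m) component k i (u + a *: (v - u)) <= \sum_(i < m) component k i u
      + a * (\sum_(i < m) component k i v - \sum_(i < m) component k i u).
  move=> a0 a1; rewrite -sumrB mulr_sumr -big_split /=.
  by apply: ler_sum => i _; exact: component_convex.
have c0 : 0 < (2 * t k)^-1 by rewrite invr_gt0 mulr_gt0.
have := prox_three_point X_convex cM c0 xmin Xy.
rewrite (enormBC y) (enormBC y) -(ler_pM2l (_ : 0 < 2 * t k)) ?mulr_gt0 //.
rewrite !mulrDr !mulrA divff ?mulf_neq0 ?gt_eqF //; lra.
Qed.

(** Take [y = x k] in the three-point inequality, bound the model decrease by its Lipschitz
    constant, and divide by the step length. *)
Lemma iterate_step k : enorm (x k.+1 - x k) <= m%:R * C * t k.
Proof.
have tk : 0 < t k by case: algorithm.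
have := iterate_three_point k (iterate_mem k).
have : \sum_(i < m) component k i (x k) - \sum_(i < m) component k i (x k.+1)
    <= m%:R * C * enorm (x k.+1 - x k).
  rewrite -sumrB -mulrA mulr_natl -[X in _ *+ X]card_ord -sumr_const.
  by apply: ler_sum => i _; rewrite (enormBC (x k.+1)); exact: component_lipschitz.
rewrite subrr enorm0.
have := enorm_ge0 (x k.+1 - x k).
rewrite le_eqVlt => /predU1P[<- _ _|d0 h1 h2].
  by rewrite !mulr_ge0 // ltW.
rewrite -(ler_pM2l d0); nra.
Qed.

Hypothesis t_nonincreasing : forall k, t k.+1 <= t k.

Lemma step_le i j : t (i + j)%N <= t i.
Proof. by elim: j => [|j]; rewrite ?addn0 // addnS; apply: le_trans. Qed.

Lemma iterate_drift j k :
  enorm (x (j + k)%N - x j) <= k%:R * (m%:R * C * t j).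
Proof.
elim: k => [|k IH].
  by rewrite addn0 subrr mul0r enorm0.
rewrite addnS; apply: le_trans (enormB_trans _ (x (j + k)%N) _) _.
have := iterate_step (j + k); rewrite -natr1 mulrDl mul1r.
have : m%:R * C * t (j + k)%N <= m%:R * C * t j.
  by rewrite ler_wpM2l ?step_le // mulr_ge0 // ltW.
lra.
Qed.

Hypothesis schedule : forall k i, (i \in \bigcup_(l < W) I (k + l)%N)%SET.

(** At iteration [p + W.-1] the memory spans exactly iterations [p] to [p + W.-1]; an evaluation at
    [p + l] has age [W.-1 - l]. *)
Lemma memory_neq0 p i : memory (p + W.-1) i != finset.set0.
Proof.
have W0 : (0 < W)%N by case: algorithm.
have /bigcupP[l _ il] := schedule p i.
have lW : (W.-1 - l < (minn (p + W.-1) W.-1).+1)%N.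
  by rewrite ltnS leq_min leq_subr andbT (leq_trans (leq_subr _ _)) ?leq_addl.
apply/finset.set0Pn; exists (Ordinal lW); rewrite inE /=.
suff -> : (p + W.-1 - (W.-1 - l) = p + l)%N by [].
have := ltn_ord l; lia.
Qed.

Local Notation F := (fun y => \sum_(i < m) f i y).

(** The oldest cut is based at [x p], which is [W] steps before the new iterate, and [t p] dominates
    every step size in between. *)
Lemma memory_drift p (l : 'I_(minn (p + W.-1) W.-1).+1) :
  enorm (x (p + W.-1).+1 - x (p + W.-1 - l)) <= W%:R * (m%:R * C * t p).
Proof.
have W0 : (0 < W)%N by case: algorithm.
have lW : (l <= W.-1)%N by have := ltn_ord l; lia.
have {1}-> : ((p + W.-1).+1 = (p + W.-1 - l) + l.+1)%N by lia.
apply: le_trans (iterate_drift _ _) _.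
have -> : (p + W.-1 - l = p + (W.-1 - l))%N by lia.
have t0 : 0 < t (p + (W.-1 - l))%N by case: algorithm.
have mC : 0 <= m%:R * C by rewrite mulr_ge0 // ltW.
apply: ler_pM; rewrite ?mulr_ge0 ?(ltW C_gt0) ?(ltW t0) ?ler_nat //; first lia.
by rewrite ler_wpM2l ?step_le.
Qed.

Lemma iterate_descent p y : X y ->
  enorm (x (p + W.-1).+1 - y) ^+ 2 <= enorm (x (p + W.-1)%N - y) ^+ 2
    - t (p + W.-1)%N * (2 * (F (x (p + W.-1).+1) - F y))
    + 4 * m%:R ^+ 2 * C ^+ 2 * W%:R * t p ^+ 2.
Proof.
move=> Xy; set k := (p + W.-1)%N.
have tk : 0 < t k by case: algorithm.
have My : \sum_(i < m) component k i y <= F y.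
  by apply: ler_sum => i _; exact/component_le/memory_neq0.
(* The model error per component: [component_ge] with the radius of [memory_drift]. *)
set E := 2 * C * (W%:R * (m%:R * C * t p)).
have Mx : F (x k.+1) - m%:R * E <= \sum_(i < m) component k i (x k.+1).
  have -> : m%:R * E = \sum_(i < m) E by rewrite sumr_const card_ord mulr_natl.
  rewrite -sumrB; apply: ler_sum => i _.
  apply: component_ge (iterate_mem _) (memory_neq0 _ _) _ => l.
  exact: memory_drift.
have := iterate_three_point k Xy; have := sqr_ge0 (enorm (x k.+1 - x k)).
have E0 : 0 <= m%:R * E.
  by rewrite /E !mulr_ge0 // ?(ltW C_gt0) // ltW //; case: algorithm.
have : t k * (m%:R * E) <= t p * (m%:R * E) by rewrite ler_wpM2r // step_le.
have -> : 4 * m%:R ^+ 2 * C ^+ 2 * W%:R * t p ^+ 2 = 2 * (t p * (m%:R * E)).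
  by rewrite /E; ring.
nra.
Qed.

End Algorithm.

(** * Convergence of the iterates *)

Theorem proposition2p9 (R : realType) (n m : nat)
    (X : set 'rV[R]_n) (f : 'I_m -> 'rV[R]_n -> R) (C : R)
    (X_nonempty : X !=set0) (X_closed : closed X)
    (X_convex : convex_set X)
    (f_convex : forall i, convex_function setT (f i))
    (f_subdifferentiable :
      forall i x, X x -> subdifferential (f i) x !=set0)
    (C_gt0 : 0 < C)
    (subgradient_bound : forall i x g,
      X x -> subdifferential (f i) x g -> enorm g <= C)
    (W : nat) (t : nat -> R) (I : nat -> {set 'I_m})
    (x : nat -> 'rV[R]_n) (g : nat -> 'I_m -> 'rV[R]_n)
    (algorithm : incremental_cutting_plane f W t I x g X)
    (schedule : forall k i, (i \in \bigcup_(l < W) I (k + l)%N)%SET)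
    (t_gt0 : forall k, 0 < t k)
    (t_nonincreasing : forall k, t k >= t k.+1)
    (t_sum : (\sum_(0 <= k <oo) (t k)%:E = +oo)%E)
    (t_sum_sqr : (\sum_(0 <= k <oo) (t k ^+ 2)%:E < +oo)%E)
    (optimal_nonempty :
      optimal_set X (fun y => \sum_(i < m) f i y) !=set0) :
  exists2 z, optimal_set X (fun y => \sum_(i < m) f i y) z &
    x k @[k --> \oo] --> z.
Proof.
have [z0 [Xz0 optz0]] := optimal_nonempty.
set F := (fun y => \sum_(i < m) f i y).
have Fmin y : X y -> F z0 <= F y.
  move=> Xy; rewrite -lee_fin [X in (X <= _)%E]optz0.
  by apply: ereal_inf_lbound; exists y.
set K := 4 * m%:R ^+ 2 * C ^+ 2 * W%:R.
have descent y p (Xy : X y) := @iterate_descent R n m X f C W t I x g X_convex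
  f_subdifferentiable C_gt0 subgradient_bound algorithm t_nonincreasing schedule
  p y Xy.
have K0 : 0 <= K by rewrite /K !mulr_ge0 ?exprn_ge0 // ltW.
have b0 k : 0 <= K * t k ^+ 2 by rewrite mulr_ge0 ?sqr_ge0.
have [S tS] : exists S, forall k, \sum_(0 <= i < k) t i ^+ 2 <= S.
  by apply: nneseries_lty_ub => // k; exact: sqr_ge0.
have bS k : \sum_(0 <= i < k) K * t i ^+ 2 <= K * S.
  by rewrite -mulr_sumr ler_wpM2l.
(* Dropping the first [W.-1] step sizes keeps the sum divergent. *)
have sI A : exists k, A < \sum_(0 <= i < k) t (i + W.-1)%N.
  have [k hk] := nneseries_pinfty_unbounded (fun k => ltW (t_gt0 k)) t_sum
    (A + \sum_(0 <= i < W.-1) t i).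
  have shift : \sum_(0 <= i < k) t (i + W.-1)%N = \sum_(W.-1 <= i < W.-1 + k) t i.
    by rewrite -{2}(add0n W.-1) big_addn addKn.
  exists k; rewrite shift -(ltrD2r (\sum_(0 <= i < W.-1) t i)).
  apply: lt_le_trans hk _; rewrite addrC -big_cat_nat ?leq_addr //=.
  rewrite (big_cat_nat (leq0n k) (leq_addl _ _)) lerDl.
  by apply: sumr_ge0 => i _; exact/ltW/t_gt0.
have Xx := iterate_mem algorithm.
have liminf e N : 0 < e -> exists2 p, (N <= p)%N & F (x (p + W.-1).+1) < F z0 + e.
  move=> e0.
  have e2 : 0 < 2 * e by rewrite mulr_gt0.
  have [p Np dp] := descent_inf (fun p => sqr_ge0 _) (fun p => descent z0 p Xz0)
    (fun p => ltW (t_gt0 _)) sI b0 bS N e2.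
  by exists p => //; move: dp; rewrite -/(F _) -/(F _); lra.
(* For optimal [y] the function gap is nonnegative, leaving a quasi-Fejér inequality. *)
have mono y p : X y -> F y = F z0 ->
    enorm (x (p.+1 + W.-1)%N - y) ^+ 2
      <= enorm (x (p + W.-1)%N - y) ^+ 2 + K * t p ^+ 2.
  move=> Xy Fy; have := descent y p Xy; rewrite -/(F _) -/(F _) -/K Fy addSn.
  have Fx : 0 <= 2 * (F (x (p + W.-1).+1) - F z0).
    by rewrite mulr_ge0 // subr_ge0 Fmin.
  have := mulr_ge0 (ltW (t_gt0 (p + W.-1)%N)) Fx; lra.
have /boolp.choice[phi hphi] N : exists p, (N <= p)%N /\
    F (x (p + W.-1).+1) < F z0 + N.+1%:R^-1.
  by have [|p] := liminf N.+1%:R^-1 N; [rewrite invr_gt0 | exists p].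
(* A minimizing selection of iterates; [phi] need not be monotone, as [N <= phi N] is enough. *)
pose v N := x ((phi N).+1 + W.-1)%N.
(* A bound on the square bounds the norm [r] itself, because [r <= r ^+ 2 + 1]. *)
have vM N : enorm (v N - z0) <= enorm (x (0 + W.-1)%N - z0) ^+ 2 + K * S + 1.
  have := quasi_fejer_bounded (fun p => mono z0 p Xz0 erefl) bS (phi N).+1.
  rewrite -/(v N); have := sqr_ge0 (enorm (v N - z0) - 1); nra.
have [z vz] := seq_cluster vM.
have Xz : X z.
  apply: X_closed => B /nbhs_ballP[e /= e0 zB].
  have [k _ zk] := vz e 0%N e0; exists (v k); split; first exact: Xx.
  by apply: zB; rewrite -ball_normE /=; exact: le_lt_trans (mx_norm_le_enorm _) zk.
have Fz : F z = F z0.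
  apply/eqP; rewrite eq_le Fmin // andbT; apply/ler_addgt0Pr => e e0.
  have D0 : 0 < m%:R * C + 1 by rewrite ltr_wpDl // mulr_ge0 // ltW.
  (* Chosen so that [e] splits into [m%:R * C * d] for moving from [z] to [v k] and [d] for the
     optimality gap of [v k]. *)
  set d := e / (m%:R * C + 1).
  have d0 : 0 < d by rewrite divr_gt0.
  have ed : e = m%:R * (C * d) + d.
    by rewrite /d mulrA -[X in _ + X]mul1r -mulrDl mulrC divfK // gt_eqF.
  (* Starting from this index makes the gap bound [k.+1%:R^-1] smaller than [d]. *)
  have [k Nk zk] := vz d (Num.truncn d^-1) d0.
  have kd : k.+1%:R^-1 < d.
    rewrite invf_plt ?posrE //; apply: lt_le_trans (truncnS_gt _) _.
    by rewrite ler_nat ltnS.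
  have [_] := hphi k; rewrite -addSn -/(v k).
  have : F z - m%:R * (C * d) <= F (v k).
    have -> : m%:R * (C * d) = \sum_(i < m) C * d.
      by rewrite sumr_const card_ord mulr_natl.
    rewrite -sumrB; apply: ler_sum => i _.
    have := lower_lipschitz f_subdifferentiable subgradient_bound i (v k) Xz.
    by apply: le_trans; rewrite lerB // enormBC ler_wpM2l ?ltW.
  move=> /le_lt_trans h /h; rewrite ed ltrBlDr => /ltW/le_trans; apply.
  by rewrite -addrA (addrC _^-1) lerD2l lerD2l ltW.
exists z.
  by split=> //; rewrite -[LHS]/(F z)%:E Fz.
have zinf e N : 0 < e ->
    exists2 p, (N <= p)%N & enorm (x (p + W.-1)%N - z) ^+ 2 < e.
  move=> e0.
  (* A distance below both 1 and [e] has its square below [e]. *)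
  have d0 : 0 < Num.min 1 e by rewrite lt_min ltr01.
  have [k Nk zk] := vz _ N d0; have [kp _] := hphi k.
  exists (phi k).+1; first by rewrite ltnW // ltnS (leq_trans Nk).
  rewrite -/(v k) enormBC; move: zk; rewrite lt_min => /andP[z1 ze].
  have := enorm_ge0 (z - v k); nra.
apply: cvg_enorm => e e0.
(* Applied to squared distances, hence the threshold [e ^+ 2]; the index shift [W.-1] is undone
   afterwards. *)
have [N hN] := quasi_fejer_cvg0 (fun p => mono z p Xz Fz) b0 bS zinf (exprn_gt0 2 e0).
exists (N + W.-1)%N => k Nk.
have Wk : (W.-1 <= k)%N := leq_trans (leq_addl _ _) Nk.
have := hN (k - W.-1)%N; rewrite leq_subRL // addnC subnK // => /(_ Nk).
rewrite enormBC.
by rewrite ltr_sqr ?nnegrE ?enorm_ge0 // ltW.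
Qed.
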